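(* Let $i\in[n-1]$. The map $\phi_i$ is well-defined, i.e., $\phi_i(\mathcal B)\in\mathrm{BPD}(n)$ for every $\mathcal B\in\mathrm{BPD}(n)$. Moreover, let $A\in\mathrm{ASM}(n)$ and $\mathcal B=\Phi(A)$. Then $\phi_i(\mathcal B)$ is the bumpless pipe dream associated (via $\Phi$) to the maximum element of $\pi_i^{-1}(\pi_i(A))=\{C\in\mathrm{ASM}(n):\pi_i(C)=\pi_i(A)\}$ in strong order.
   Context: $[n]=\{1,\dots,n\}$. An $n\times n$ alternating sign matrix (ASM) is a matrix $A=(A_{i,j})$ with entries in $\{-1,0,1\}$ such that $\sum_{j=1}^m A_{i,j}\in\{0,1\}$ for all $i,m\in[n]$, $\sum_{i=1}^m A_{i,j}\in\{0,1\}$ for all $j,m\in[n]$, and the sum of all entries is $n$; $\mathrm{ASM}(n)$ is the set of these. The corner sum function of $A$ is $\mathrm{rk}_A(i,j)=\sum_{a\in[i],\,b\in[j]}A_{a,b}$. Strong order on $\mathrm{ASM}(n)$: $A\le B$ iff $\mathrm{rk}_A(i,j)\ge \mathrm{rk}_B(i,j)$ for all $i,j\in[n]$. For $i\in[n-1]$, $\pi_i(A)$ is the minimum, in strong order, of $\{B\in\mathrm{ASM}(n): \mathrm{rk}_B(a,b)=\mathrm{rk}_A(a,b)\text{ for all }a,b\in[n]\text{ with }a\ne i\}$ (this minimum is known to exist). It is known that $\pi_i^{-1}(\pi_i(A))$ is a sublattice of $\mathrm{ASM}(n)$. Bumpless pipe dreams: in an $n\times n$ grid with matrix coordinates (row 1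 on top), fill each cell with one of six tiles, each determined by which of the midpoints of its edges Left, Right, Top, Bottom are met by pipe segments: blank (none), horizontal (L,R), vertical (T,B), cross (L,R,T,B; a horizontal and a vertical segment crossing), the ''r-tile'' (an elbow joining B and R), and the ''j-tile'' (an elbow joining L and T). A bumpless pipe dream is such a tiling forming a network of exactly $n$ pipes, each starting at the bottom edge of the grid and exiting at the right edge. $\mathrm{BPD}(n)$ is the set of these. There is a bijection $\mathrm{BPD}(n)\to\mathrm{ASM}(n)$ sending $\mathcal B$ to the matrix with entry $1$ at the r-tiles, $-1$ at the j-tiles, and $0$ elsewhere; $\Phi:\mathrm{ASM}(n)\to\mathrm{BPD}(n)$ denotes the inverse bijection. The map $\phi_i$ ($i\in[n-1]$): a pipe in row $i$ of $\mathcal B$ crossing from column $j$ to column $j+1$ is a droppable column crossing for $i$ if no pipe in row $i+1$ crosses from column $j$ to column $j+1$. Let $\mathrm{dc}_i(\mathcal B)$ be the set of the column indices $j$ of such crossings, written as a disjoint union of maximal intervals $[a_1,b_1]\sqcup\cdots\sqcup[a_k,b_k]$ of integers, with $a_h\le b_h$ and $b_h+1<a_{h+1}$. For each $h\in[k]$, within the rectangle of cells $[i,i+1]\times[a_h,b_h+1]$ make the following replacements (simultaneously for all $h$; the column ranges $[a_h,b_h+1]$ are disjoint): (1) delete the horizontal pipe segment in row $i$ from the midpoint of column $a_h$ to the midpoint of column $b_h+1$; (2) draw a horizontal pipe segment in row $i+1$ from the midpoint of column $a_h$ to the midpoint of column $b_h+1$; (3) delete the vertical pipe segment in column $a_h$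 from the midpoint of row $i$ to the midpoint of row $i+1$; (4) draw a vertical pipe segment in column $b_h+1$ from the midpoint of row $i$ to the midpoint of row $i+1$. The resulting diagram (each cell of which is read off as the tile determined by the edge midpoints met by segments) is $\phi_i(\mathcal B)$. *)

(* Defs.v *)
From HB Require Import structures.
From mathcomp Require Export all_boot all_order all_algebra.
From mathcomp Require Import boolp classical_sets.
Set Implicit Arguments.
Unset Strict Implicit.
Unset Printing Implicit Defensive.

Import Order.TTheory GRing.Theory Num.Theory.

Local Open Scope ring_scope.

(* Rows and columns are numbered from 0, so [n] is 'I_n, row 0 is on top, and
   an index i in [n-1] is a natural number i with i.+1 < n. *)

Definition is_asm (n : nat) (A : 'M[int]_n) : Prop :=
  [/\ forall i j : 'I_n, A i j \in [:: -1; 0; 1],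
      forall i m : 'I_n, \sum_(j < n | (j <= m)%N) A i j \in [:: 0; 1],
      forall j m : 'I_n, \sum_(i < n | (i <= m)%N) A i j \in [:: 0; 1]
    & \sum_(i < n) \sum_(j < n) A i j = n%:Z].

Definition rk (n : nat) (A : 'M[int]_n) (i j : 'I_n) : int :=
  \sum_(a < n | (a <= i)%N) \sum_(b < n | (b <= j)%N) A a b.

(* Larger matrices have smaller corner sums. *)
Definition strong_le (n : nat) (A B : 'M[int]_n) : Prop :=
  forall i j : 'I_n, rk B i j <= rk A i j.

Definition is_minimum (n : nat) (S : 'M[int]_n -> Prop) (M : 'M[int]_n) : Prop :=
  S M /\ forall B, S B -> strong_le M B.

Definition is_maximum (n : nat) (S : 'M[int]_n -> Prop) (M : 'M[int]_n) : Prop :=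
  S M /\ forall B, S B -> strong_le B M.

Definition agree_off_row (n : nat) (i : nat) (A B : 'M[int]_n) : Prop :=
  is_asm B /\ forall a b : 'I_n, a != i :> nat -> rk B a b = rk A a b.

(* The default value A of xget is irrelevant: for A an alternating sign matrix
   and i.+1 < n the minimum exists, and it is unique. *)
Definition asm_pi (n : nat) (i : nat) (A : 'M[int]_n) : 'M[int]_n :=
  xget A (is_minimum (agree_off_row i A)).

Definition asm_pi_fiber (n : nat) (i : nat) (A C : 'M[int]_n) : Prop :=
  is_asm C /\ asm_pi i C = asm_pi i A.

Inductive side := Left | Right | Top | Bottom.

Definition side_code (s : side) : bool * bool :=
  match s with
  | Left => (false, false) | Right => (false, true)
  | Top => (true, false) | Bottom => (true, true)
  end.

Definition side_decode (x : bool * bool) : side :=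
  match x with
  | (false, false) => Left | (false, true) => Right
  | (true, false) => Top | (true, true) => Bottom
  end.

Lemma side_codeK : cancel side_code side_decode.
Proof. by case. Qed.

HB.instance Definition _ := Finite.copy side (can_type side_codeK).

(* A cell is the set of sides whose midpoint is joined to the center of the
   cell by a segment; a diagram fills every position of the grid by an
   arbitrary such set, not necessarily by one of the six tiles. *)
Notation cell := {set side}.
Notation diagram n := 'M[cell]_n.

Definition blank_tile : cell := finset.set0.
Definition horizontal_tile : cell := [set Left; Right]%SET.
Definition vertical_tile : cell := [set Top; Bottom]%SET.
Definition cross_tile : cell := [set Left; Right; Top; Bottom]%SET.
Definition r_tile : cell := [set Bottom; Right]%SET.
Definition j_tile : cell := [set Left; Top]%SET.

Definition tiles : seq cell :=
  [:: blank_tile; horizontal_tile; vertical_tile; cross_tile; r_tile; j_tile].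

(* has_strand t s s' : in the tile t a pipe entering at s leaves at s', where
   pipes are travelled from the bottom edge of the grid to the right edge.
   In the cross tile the two pipes go straight. *)
Definition has_strand (t : cell) (s s' : side) : bool :=
  match s, s' with
  | Left, Right => (t == horizontal_tile) || (t == cross_tile)
  | Bottom, Top => (t == vertical_tile) || (t == cross_tile)
  | Bottom, Right => t == r_tile
  | Left, Top => t == j_tile
  | _, _ => false
  end.

(* ((r, c), (s, s')) : the strand from s to s' in the cell (r, c) *)
Notation strand n := (('I_n * 'I_n) * (side * side))%type.

Definition is_strand (n : nat) (D : diagram n) (x : strand n) : bool :=
  has_strand (D x.1.1 x.1.2) x.2.1 x.2.2.

Definition follows (n : nat) (x y : strand n) : bool :=
  let: ((r, c), (_, s)) := x in
  let: ((r', c'), (s', _)) := y in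
  match s with
  | Right => [&& r' == r, c' == c.+1 :> nat & s' == Left]
  | Top => [&& r == r'.+1 :> nat, c' == c & s' == Bottom]
  | _ => false
  end.

Definition starts_at_bottom (n : nat) (x : strand n) : bool :=
  (x.1.1.+1 == n) && (x.2.1 == Bottom).

Definition exits_at_right (n : nat) (x : strand n) : bool :=
  (x.1.2.+1 == n) && (x.2.2 == Right).

Definition is_pipe (n : nat) (D : diagram n) (p : seq (strand n)) : bool :=
  if p is x :: q then
    [&& all (is_strand D) p, starts_at_bottom x, path (@follows n) x q
      & exits_at_right (last x q)]
  else false.

(* The n pipes use every strand of the tiling exactly once. *)
Definition is_bpd (n : nat) (D : diagram n) : Prop :=
  (forall r c : 'I_n, D r c \in tiles) /\
  exists P : seq (seq (strand n)),
    [/\ size P = n, all (is_pipe D) P, uniq (flatten P)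
      & forall x : strand n, (x \in flatten P) = is_strand D x].

Definition bpd_asm (n : nat) (D : diagram n) : 'M[int]_n :=
  \matrix_(r, c) (if D r c == r_tile then 1
                  else if D r c == j_tile then -1 else 0).

(* The inverse of the bijection D |-> bpd_asm D from bumpless pipe dreams to
   alternating sign matrices; the default value of xget is irrelevant there. *)
Definition Phi (n : nat) (A : 'M[int]_n) : diagram n :=
  xget (const_mx blank_tile) (fun D : diagram n => is_bpd D /\ bpd_asm D = A).

(* Nothing is drawn outside of the grid. *)
Definition cell_at (n : nat) (D : diagram n) (r c : nat) : cell :=
  match (insub r : option 'I_n), (insub c : option 'I_n) with
  | Some r', Some c' => D r' c'
  | _, _ => finset.set0
  end.

(* a pipe in row r crosses from column c to column c.+1 *)
Definition column_crossing (n : nat) (D : diagram n) (r c : nat) : bool :=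
  (Right \in cell_at D r c) && (Left \in cell_at D r c.+1).

Definition dc (n : nat) (i : nat) (D : diagram n) (c : nat) : bool :=
  column_crossing D i c && ~~ column_crossing D i.+1 c.

(* [a, b] is a maximal interval of droppable column crossings *)
Definition dc_interval (n : nat) (i : nat) (D : diagram n) (a b : nat) : bool :=
  [&& (a <= b)%N, all (dc i D) (iota a (b.+1 - a)),
      (a == 0%N) || ~~ dc i D a.-1 & ~~ dc i D b.+1].

(* on_horizontal r0 c1 c2 r c s : the half-segment from the center of the cell
   (r, c) to its side s lies on the horizontal segment in row r0 from the
   midpoint of column c1 to the midpoint of column c2 *)
Definition on_horizontal (r0 c1 c2 r c : nat) (s : side) : bool :=
  (r == r0) &&
  match s with
  | Right => (c1 <= c < c2)%N
  | Left => (c1 < c <= c2)%N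
  | _ => false
  end.

Definition on_vertical (c0 r1 r2 r c : nat) (s : side) : bool :=
  (c == c0) &&
  match s with
  | Bottom => (r1 <= r < r2)%N
  | Top => (r1 < r <= r2)%N
  | _ => false
  end.

Definition phi_deleted (n : nat) (i : nat) (D : diagram n) (r c : nat) : cell :=
  [set s : side | [exists a : 'I_n, exists b : 'I_n, dc_interval i D a b &&
     (on_horizontal i a b.+1 r c s || on_vertical a i i.+1 r c s)]]%SET.

Definition phi_drawn (n : nat) (i : nat) (D : diagram n) (r c : nat) : cell :=
  [set s : side | [exists a : 'I_n, exists b : 'I_n, dc_interval i D a b &&
     (on_horizontal i.+1 a b.+1 r c s || on_vertical b.+1 i i.+1 r c s)]]%SET.

Definition phi (n : nat) (i : nat) (D : diagram n) : diagram n :=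
  \matrix_(r, c) ((D r c :\: phi_deleted i D r c) :|: phi_drawn i D r c)%SET.

(* Main.v *)
Require Import Defs.
From mathcomp Require Import zify boolp classical_sets.

Set Implicit Arguments.
Unset Strict Implicit.
Unset Printing Implicit Defensive.

Import Order.TTheory GRing.Theory Num.Theory.

Local Open Scope ring_scope.

(** Everything is read off the corner sums of an alternating sign matrix, seen
    as a function [f] on the vertices [(a, b)], [0 <= a, b <= n], of the grid:
    [f a b] is the sum of the entries in the first [a] rows and the first [b]
    columns.  The functions that arise are those with the obvious boundary
    values and with steps 0 or 1 along rows and along columns
    ([corner_csum], [asm_corner_matrix]).

    The bumpless pipe dream of a matrix consists of the level lines of [f]: a
    pipe crosses the segment between two adjacent vertices exactly when [f]
    differs at its ends ([draw]).  That this inverts the map from pipe dreams to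
    matrices ([Phi_draw]) rests on a local description of pipe dreams: a filling
    by the six tiles is a network of [n] pipes if and only if neighbouring
    tiles match and only the right and the bottom edges of the grid are met, at
    all their places ([bpd_coherent], [coherent_bpd]).

    Fix all the values of [f] except those on the vertices [(i.+1, b)], which
    lie between the rows [i] and [i.+1] of cells.  The steps along columns force
    [f i.+1 b] to lie between [max (f i b) (f i.+2 b - 1)] and
    [min (f i b + 1) (f i.+2 b)].  Both bounds are attained for all [b] at once,
    since a maximum or a minimum of two sequences with integer values and steps
    0 or 1 has such steps too ([corner_lower], [corner_upper]).  The upper
    bound gives [asm_pi i A], so the fiber of [asm_pi i] consists of the
    matrices that agree with [A] off that line ([asm_pi_fiberE]), and the lower
    bound gives its maximum ([asm_pi_fiber_maximum]).

    On the other hand the lower bound differs from [f i.+1 b], by 1, exactly if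
    [f i.+1 b = f i b + 1] and [f i.+2 b = f i.+1 b], that is, if a pipe crosses
    column line [b] in row [i] and none does in row [i.+1].  Lowering [f] there
    moves these crossings from row [i] to row [i.+1], and it changes the
    vertical edges between the two rows only at the ends of each run of such
    crossings.
    This is what [phi i] does ([phi_draw]). *)

(** * Corner sums at the vertices of the grid *)

Definition psum (n : nat) (F : 'I_n -> int) (b : nat) : int :=
  \sum_(x < n | (x < b)%N) F x.

(** [csum A a b] belongs to the vertex of the grid below the first [a] rows and
    to the right of the first [b] columns, so that it is [rk] with both indices
    shifted by one, extended by a zero row and a zero column. *)
Definition csum (n : nat) (A : 'M[int]_n) (a b : nat) : int :=
  psum (fun x => psum (A x) b) a.

Lemma psum0 n (F : 'I_n -> int) : psum F 0 = 0.
Proof. exact: big_pred0. Qed.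

Lemma psumS n (F : 'I_n -> int) (r : 'I_n) : psum F r.+1 = psum F r + F r.
Proof.
rewrite /psum (bigD1 r) //= addrC; congr (_ + _).
by apply: eq_bigl => x; rewrite -val_eqE /=; lia.
Qed.

Lemma psum_all n (F : 'I_n -> int) : psum F n = \sum_(x < n) F x.
Proof. by apply: eq_bigl => x; rewrite ltn_ord. Qed.

Lemma psum_telescope n (F : 'I_n -> int) (g : nat -> int) :
    (forall x : 'I_n, F x = g x.+1 - g x) ->
  forall b, (b <= n)%N -> psum F b = g b - g 0%N.
Proof.
move=> Fg; elim=> [|b IH] lebn; first by rewrite psum0 subrr.
by rewrite (psumS F (Ordinal lebn)) IH ?Fg /=; lia.
Qed.

Lemma csumC n (A : 'M[int]_n) a b :
  csum A a b = psum (fun y => psum (fun x => A x y) a) b.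
Proof. exact: exchange_big. Qed.

Lemma csumSl n (A : 'M[int]_n) (r : 'I_n) b :
  csum A r.+1 b = csum A r b + psum (A r) b.
Proof. exact: psumS. Qed.

Lemma csumSr n (A : 'M[int]_n) a (c : 'I_n) :
  csum A a c.+1 = csum A a c + psum (fun x => A x c) a.
Proof. by rewrite !csumC psumS. Qed.

Lemma csum0l n (A : 'M[int]_n) b : csum A 0 b = 0.
Proof. exact: psum0. Qed.

Lemma csum0r n (A : 'M[int]_n) a : csum A a 0 = 0.
Proof. by rewrite csumC psum0. Qed.

Lemma entry_csum n (A : 'M[int]_n) (r c : 'I_n) :
  A r c = csum A r.+1 c.+1 - csum A r.+1 c - (csum A r c.+1 - csum A r c).
Proof. by rewrite !csumSl psumS; lia. Qed.

Lemma csum_inj n (A B : 'M[int]_n) :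
    (forall a b, (a <= n)%N -> (b <= n)%N -> csum A a b = csum B a b) ->
  A = B.
Proof.
move=> AB; apply/matrixP => r c.
have [lern lecn] := (ltn_ord r, ltn_ord c).
by rewrite !entry_csum !AB // ltnW.
Qed.

(** The steps between adjacent vertices are the partial row and column sums
    that an alternating sign matrix requires to be 0 or 1. *)
Definition corner_function (n : nat) (f : nat -> nat -> int) : Prop :=
  [/\ forall b, (b <= n)%N -> f 0%N b = 0 /\ f n b = b%:Z,
      forall a, (a <= n)%N -> f a 0%N = 0 /\ f a n = a%:Z,
      forall a b, (a < n)%N -> (b <= n)%N -> f a b <= f a.+1 b <= f a b + 1
    & forall a b, (a <= n)%N -> (b < n)%N -> f a b <= f a b.+1 <= f a b + 1].

(** With [n] steps of at most 1 to climb to [n], no step can be 0. *)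
Lemma full_speed n (g : nat -> int) :
    g 0%N = 0 -> g n = n%:Z ->
    (forall a, (a < n)%N -> g a <= g a.+1 <= g a + 1) ->
  forall a, (a <= n)%N -> g a = a%:Z.
Proof.
move=> g0 gn gS a lean; apply/eqP; rewrite eq_le; apply/andP; split.
  elim: a lean => [|a IH] lean; first by rewrite g0.
  by have := gS a lean; have := IH (ltnW lean); lia.
(* For the lower bound: the last [k] steps gain at most [k]. *)
suff: forall k, (k <= n)%N -> g n <= g (n - k)%N + k%:Z.
  by move/(_ (n - a)%N (leq_subr _ _)); rewrite subKn // gn; lia.
elim=> [|k IH] lekn; first by rewrite subn0; lia.
have lt : (n - k.+1 < n)%N by lia.
have := gS _ lt; have := IH (ltnW lekn).
have -> : (n - k.+1).+1 = (n - k)%N by lia.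
lia.
Qed.

(** The definition fixes the total sum only.  That each complete row or column
    sums to 1 follows from [full_speed]: the [n] complete row sums are 0 or 1
    and add up to [n]. *)
Lemma corner_csum n (A : 'M[int]_n) :
  is_asm A -> corner_function n (csum A).
Proof.
case=> _ rowA colA sumA.
have step01 (F : 'I_n -> int) : (forall m : 'I_n, psum F m.+1 \in [:: 0; 1]) ->
    forall b, (b <= n)%N -> 0 <= psum F b <= 1.
  move=> F01 [|b] lebn; first by rewrite psum0.
  by have := F01 (Ordinal lebn); rewrite !inE /=; lia.
have stepl a b : (a < n)%N -> (b <= n)%N ->
    csum A a b <= csum A a.+1 b <= csum A a b + 1.
  move=> ltan lebn; have := csumSl A (Ordinal ltan) b => /= ->.
  by have := step01 _ (rowA (Ordinal ltan)) b lebn; lia.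
have stepr a b : (a <= n)%N -> (b < n)%N ->
    csum A a b <= csum A a b.+1 <= csum A a b + 1.
  move=> lean ltbn; have := csumSr A a (Ordinal ltbn) => /= ->.
  by have := step01 _ (colA (Ordinal ltbn)) a lean; lia.
have csum_nn : csum A n n = n%:Z.
  by rewrite /csum psum_all -[RHS]sumA; apply: eq_bigr => x _; rewrite psum_all.
split=> // [b lebn|a lean]; split; rewrite ?csum0l ?csum0r //.
  by apply: (full_speed _ _ _ lebn) => [|//|b' lt]; rewrite ?csum0r // stepr.
apply: (@full_speed n (fun a => csum A a n)) => // [|a' lt].
  by rewrite csum0l.
by rewrite stepl.
Qed.

Definition corner_matrix (n : nat) (f : nat -> nat -> int) : 'M[int]_n :=
  \matrix_(r, c) (f r.+1 c.+1 - f r.+1 c - (f r c.+1 - f r c)).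

Lemma psum_row_corner n f (r : 'I_n) b : corner_function n f -> (b <= n)%N ->
  psum (corner_matrix n f r) b = f r.+1 b - f r b.
Proof.
case=> [_ f0 _ _] lebn; have [lern lern'] := (ltn_ord r, ltnW (ltn_ord r)).
rewrite (@psum_telescope _ _ (fun b => f r.+1 b - f r b)) //=.
  by have [-> _] := f0 _ lern; have [-> _] := f0 _ lern'; lia.
by move=> c; rewrite mxE; lia.
Qed.

Lemma csum_corner_matrix n f a b : corner_function n f ->
  (a <= n)%N -> (b <= n)%N -> csum (corner_matrix n f) a b = f a b.
Proof.
move=> fP lean lebn; rewrite /csum (@psum_telescope _ _ (f^~ b)) //=.
  by case: fP => f0 _ _ _; have [-> _] := f0 _ lebn; lia.
by move=> r; rewrite psum_row_corner.
Qed.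

Lemma asm_corner_matrix n f : corner_function n f -> is_asm (corner_matrix n f).
Proof.
move=> fP; have csumf := csum_corner_matrix fP.
have psumr : forall (c : 'I_n) a, (a <= n)%N ->
    psum (fun x => corner_matrix n f x c) a = f a c.+1 - f a c.
  move=> c a lean; have [ltcn lecn] := (ltn_ord c, ltnW (ltn_ord c)).
  by have := csumSr (corner_matrix n f) a c; rewrite !csumf //; lia.
case: (fP) => fr fc stepl stepr; split.
- move=> r c; rewrite mxE !inE.
  have [ltrn ltcn] := (ltn_ord r, ltn_ord c).
  have := stepr r.+1 c ltrn ltcn; have := stepr r c (ltnW ltrn) ltcn; lia.
- move=> r c; have [ltrn ltcn] := (ltn_ord r, ltn_ord c).
  have := psum_row_corner r fP ltcn; rewrite /psum /= => ->.
  by have := stepl r c.+1 ltrn ltcn; rewrite !inE; lia.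
- move=> c r; have [ltrn ltcn] := (ltn_ord r, ltn_ord c).
  have := psumr c r.+1 ltrn; rewrite /psum /= => ->.
  by have := stepr r.+1 c ltrn ltcn; rewrite !inE; lia.
have <- : csum (corner_matrix n f) n n = n%:Z.
  by rewrite csumf //; have [_ ->] := fr n (leqnn n).
by rewrite /csum psum_all; apply: eq_bigr => x _; rewrite psum_all.
Qed.
(** * Decomposing an acyclic relation into chains *)

Section Chains.
Variables (T : eqType) (S : pred T) (e : rel T).

Lemma chain_next x q y : path e x q -> y \in x :: q ->
  y = last x q \/ exists2 z, z \in x :: q & e y z.
Proof.
elim: q x => [|z q IH] x /= => [_|/andP[exz pzq]].
  by rewrite inE => /eqP->; left.
rewrite inE => /orP[/eqP->|/(IH _ pzq)[->|]]; [|by left|].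
  by right; exists z => //; rewrite !inE eqxx orbT.
by case=> t tin eyt; right; exists t => //; rewrite inE tin orbT.
Qed.

Lemma chain_prev x q y : path e x q -> y \in x :: q ->
  y = x \/ exists2 z, z \in x :: q & e z y.
Proof.
elim: q x => [|z q IH] x /= => [_|/andP[exz pzq]].
  by rewrite inE => /eqP->; left.
rewrite inE => /orP[/eqP->|/(IH _ pzq)[->|]]; first by left.
  by right; exists x => //; rewrite inE eqxx.
by case=> t tin eyt; right; exists t => //; rewrite inE tin orbT.
Qed.

(* A bounded quantity that increases along [e] excludes cycles. *)
Variable m : T -> nat.
Hypothesis m_bound : exists N, forall x, (m x < N)%N.
Hypothesis m_incr : forall x y, e x y -> (m x < m y)%N.

Definition maximal_chain (x : T) (q : seq T) : Prop :=
  [/\ path e x q, all S (x :: q) & forall y, S y -> ~~ e (last x q) y].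

Lemma maximal_chain_exists x : S x -> exists q, maximal_chain x q.
Proof.
case: m_bound => N mN; move: {2}(N - m x)%N (leqnn (N - m x)) => k.
elim: k x => [|k IH] x lek Sx; first by have := mN x; lia.
have [[y Sy exy]|noy] := pselect (exists2 y, S y & e x y); last first.
  exists [::]; split; rewrite /= ?Sx // => y Sy.
  by apply/negP => exy; apply: noy; exists y.
have [|q [pq Sq maxq]] := IH y _ Sy.
  by have := m_incr exy; have := mN y; lia.
by exists (y :: q); split; rewrite //= ?exy ?Sx.
Qed.

Lemma chain_uniq x q : path e x q -> uniq (x :: q).
Proof.
move=> pq; apply: (@map_uniq _ _ m); apply: (@sorted_uniq _ ltn).
- exact: ltn_trans.
- exact: ltnn.
by rewrite /= path_map; apply: sub_path pq => y z; apply: m_incr.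
Qed.

Hypothesis e_fun : forall x y z, S x -> S y -> S z -> e x y -> e x z -> y = z.
Hypothesis e_inj : forall x y z, S x -> S y -> S z -> e y x -> e z x -> y = z.

(** Each chain is followed until it stops.  Going backward from an element
    one meets a single sequence of predecessors, of decreasing [m], which ends
    at a start: so the element lies on a chain, and on only one. *)
Lemma chain_decomposition (starts : seq T) :
    uniq starts -> all S starts ->
    (forall x, x \in starts -> forall y, S y -> ~~ e y x) ->
    (forall x, S x -> x \notin starts -> exists2 y, S y & e y x) ->
  exists Q : T -> seq T,
    [/\ forall x, x \in starts -> maximal_chain x (Q x),
        uniq (flatten [seq x :: Q x | x <- starts])
      & forall x, (x \in flatten [seq x :: Q x | x <- starts]) = S x].
Proof.
move=> uniq_starts /allP S_starts no_prev has_prev.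
have [Q QP] : {Q : T -> seq T & forall x, S x -> maximal_chain x (Q x)}.
  apply: (@choice _ _ (fun x q => S x -> maximal_chain x q)) => x.
  have [Sx|nSx] := boolP (S x); last by exists [::].
  by have [q qP] := maximal_chain_exists Sx; exists q.
have QS x y : x \in starts -> y \in x :: Q x -> S y.
  by move=> /S_starts/QP[_ /allP SQ _] /SQ.
have disjoint_chains k : forall y, (m y <= k)%N -> forall x1 x2,
    x1 \in starts -> x2 \in starts ->
    y \in x1 :: Q x1 -> y \in x2 :: Q x2 -> x1 = x2.
  elim: k => [|k IH] y lemyk x1 x2 x1s x2s y1 y2;
    have [p1 _ _] := QP _ (S_starts _ x1s);
    have [p2 _ _] := QP _ (S_starts _ x2s);
    have Sy := QS _ _ x1s y1;
    case: (chain_prev p1 y1) => [yx1|[z1 z1in e1]];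
    case: (chain_prev p2 y2) => [yx2|[z2 z2in e2]];
    rewrite -?yx1 -?yx2 //.
  - by have := no_prev _ x1s z2 (QS _ _ x2s z2in); rewrite -yx1 e2.
  - by have := no_prev _ x2s z1 (QS _ _ x1s z1in); rewrite -yx2 e1.
  - by have := leq_trans (m_incr e1) lemyk; rewrite ltn0.
  - by have := no_prev _ x1s z2 (QS _ _ x2s z2in); rewrite -yx1 e2.
  - by have := no_prev _ x2s z1 (QS _ _ x1s z1in); rewrite -yx2 e1.
  have z12 := e_inj Sy (QS _ _ x1s z1in) (QS _ _ x2s z2in) e1 e2.
  apply: (IH z1) => //; last by rewrite z12.
  by rewrite -ltnS (leq_trans (m_incr e1)).
have covered k : forall y, (m y <= k)%N -> S y ->
    exists2 x, x \in starts & y \in x :: Q x.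
  elim: k => [|k IH] y lemyk Sy; (have [ys|yns] := boolP (y \in starts);
    first by exists y => //; rewrite inE eqxx).
    by have [z _ /m_incr] := has_prev y Sy yns; lia.
  have [z Sz ezy] := has_prev y Sy yns.
  have [|x xs zin] := IH z _ Sz; first by have := m_incr ezy; lia.
  exists x => //; have [pq _ maxq] := QP _ (S_starts _ xs).
  case: (chain_next pq zin) => [zl|[t tin ezt]].
    by have := maxq y Sy; rewrite -zl ezy.
  by rewrite (e_fun Sz Sy (QS _ _ xs tin) ezy ezt).
exists Q; split=> [x /S_starts/QP //||x].
  have -> : flatten [seq x :: Q x | x <- starts] =
      [seq y | x <- starts, y <- x :: Q x].
    by congr flatten; apply: eq_map => x; rewrite map_id.
  apply: allpairs_uniq_dep => //.
    by move=> x /S_starts/QP[pq _ _]; apply: chain_uniq.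
  move=> p1 p2 /allpairsPdep[x1 [y1 [x1s y1in ->]]].
  move=> /allpairsPdep[x2 [y2 [x2s y2in ->]]] /= y12.
  move: y2in; rewrite -y12 => y2in.
  by rewrite (disjoint_chains _ _ (leqnn _) _ _ x1s x2s y1in y2in).
apply/flattenP/idP => [[_ /mapP[y ys ->]]|Sx]; first exact: QS.
have [y ys xin] := covered _ _ (leqnn _) Sx.
by exists (y :: Q y) => //; apply: map_f.
Qed.

End Chains.

(** * Bumpless pipe dreams as tilings that match along edges *)

Lemma cellE (t u : cell) :
  (t == u) = [&& (Left \in t) == (Left \in u), (Right \in t) == (Right \in u),
                 (Top \in t) == (Top \in u) & (Bottom \in t) == (Bottom \in u)].
Proof.
apply/eqP/and4P => [->|[/eqP L /eqP R /eqP T /eqP B]]; first by split.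
by apply/setP; case.
Qed.

(** The six tiles are the cells where as many pipes leave, at the right and at
    the top, as enter, at the left and at the bottom. *)
Lemma in_tiles (t : cell) :
  (t \in tiles) =
    ((Right \in t) + (Top \in t) == (Left \in t) + (Bottom \in t))%N.
Proof.
rewrite !inE !cellE !inE /=.
by do 4!case: (_ \in t).
Qed.
Definition incoming (s : side) : bool :=
  if s is (Left | Bottom) then true else false.

Lemma has_strand_ends t s s' : has_strand t s s' ->
  [/\ s \in t, s' \in t, incoming s & ~~ incoming s'].
Proof.
case: s; case: s' => //=;
  do ?[case/orP]; by move=> /eqP->; rewrite !inE.
Qed.

Lemma has_strand_entry t s : t \in tiles -> s \in t -> incoming s ->
  exists s', has_strand t s s'.
Proof.
rewrite in_tiles; case: s => //; case T : (Top \in t);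
  case R : (Right \in t); case B : (Bottom \in t);
  case L : (Left \in t) => //= _ _ _;
  by [exists Right; rewrite /= !cellE !inE L R T B |
      exists Top; rewrite /= !cellE !inE L R T B].
Qed.

Lemma has_strand_exit t s' : t \in tiles -> s' \in t -> ~~ incoming s' ->
  exists s, has_strand t s s'.
Proof.
rewrite in_tiles; case: s' => //; case T : (Top \in t);
  case R : (Right \in t); case B : (Bottom \in t);
  case L : (Left \in t) => //= _ _ _;
  by [exists Left; rewrite /= !cellE !inE L R T B |
      exists Bottom; rewrite /= !cellE !inE L R T B].
Qed.

Lemma has_strand_fun t s s1 s2 :
  has_strand t s s1 -> has_strand t s s2 -> s1 = s2.
Proof.
by case: s s1 s2 => [] [] [] //=; do ?[case/orP]; rewrite !cellE !inE;
   do 4!case: (_ \in t).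
Qed.

Lemma has_strand_inj t s s1 s2 :
  has_strand t s1 s -> has_strand t s2 s -> s1 = s2.
Proof.
by case: s s1 s2 => [] [] [] //=; do ?[case/orP]; rewrite !cellE !inE;
   do 4!case: (_ \in t).
Qed.

(** The local form of [is_bpd]; the neighbour of a cell is given by an
    equation between indices, which avoids arithmetic in ['I_n]. *)
Record coherent (n : nat) (D : diagram n) : Prop := Coherent {
  coherent_tile : forall r c, D r c \in tiles;
  coherent_h : forall r (c c' : 'I_n), c' = c.+1 :> nat ->
    (Left \in D r c') = (Right \in D r c);
  coherent_v : forall (r r' : 'I_n) c, r' = r.+1 :> nat ->
    (Top \in D r' c) = (Bottom \in D r c);
  coherent_left : forall r c : 'I_n, c = 0%N :> nat -> Left \notin D r c;
  coherent_top : forall r c : 'I_n, r = 0%N :> nat -> Top \notin D r c;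
  coherent_right : forall r c : 'I_n, c.+1 = n -> Right \in D r c;
  coherent_bottom : forall r c : 'I_n, r.+1 = n -> Bottom \in D r c }.

Lemma uniq_representatives (T : eqType) (P : seq (seq T)) (g : seq T -> T) :
  uniq (flatten P) -> {in P, forall p, g p \in p} -> uniq (map g P).
Proof.
elim: P => //= p P IH; rewrite cat_uniq => /and3P[_ /hasPn disj uP] gP.
rewrite IH // ?andbT => [|q qP]; last by apply: gP; rewrite inE qP orbT.
apply/negP => /mapP[q qP gpq].
have gq : g q \in flatten P.
  by apply/flattenP; exists q => //; apply: gP; rewrite inE qP orbT.
by have := disj _ gq; rewrite /= -gpq gP ?inE ?eqxx.
Qed.

(** Pipes that share no strand have distinct ends.  As there are [n] pipes and
    [n] places where a pipe can start, or stop, each place is taken: this is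
    where the number of pipes enters. *)
Lemma ends_everywhere n (P : seq (seq (strand n))) g (k : strand n -> 'I_n) :
    size P = n -> uniq (flatten P) -> {in P, forall p, g p \in p} ->
    {in P &, forall p q, k (g p) = k (g q) -> g p = g q} ->
  forall j, exists2 p, p \in P & k (g p) = j.
Proof.
move=> sizeP uP gP kinj j.
have uk : uniq [seq k x | x <- map g P].
  rewrite map_inj_in_uniq ?uniq_representatives //.
  by move=> _ _ /mapP[p pP ->] /mapP[q qP ->]; apply: kinj.
have [|_ kall] := @uniq_min_size _ _ (enum 'I_n) uk (fun x _ => mem_enum _ x).
  by rewrite size_enum_ord !size_map sizeP.
have := mem_enum 'I_n j; rewrite -kall => /mapP[_ /mapP[p pP ->] ->].
by exists p.
Qed.

(** Every strand is on a pipe, so it is continued in the neighbouring cell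
    unless its pipe starts or ends there; this matches neighbouring tiles and
    keeps pipes off the left and top edges. *)
Lemma bpd_coherent n (D : diagram n) : is_bpd D -> coherent D.
Proof.
case=> tilesD [P [sizeP /allP pipeP uP inP]].
have pipe_of x : is_strand D x -> exists y q,
    [/\ y :: q \in P, x \in y :: q, path (@follows n) y q,
        all (is_strand D) (y :: q)
      & starts_at_bottom y /\ exits_at_right (last y q)].
  rewrite -inP => /flattenP[[|y q] // yqP xin]; exists y, q.
  by have /and4P[? ? ? ?] := pipeP _ yqP; split.
have next x : is_strand D x -> ~~ exits_at_right x ->
    exists2 y, is_strand D y & follows x y.
  move=> /pipe_of[y [q [_ xin pq /allP Sq [_ ex]]]] nex.
  case: (chain_next pq xin) => [xl|[z /Sq]]; last by exists z.
  by rewrite xl ex in nex.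
have prev x : is_strand D x -> ~~ starts_at_bottom x ->
    exists2 y, is_strand D y & follows y x.
  move=> /pipe_of[y [q [_ xin pq /allP Sq [st _]]]] nst.
  case: (chain_prev pq xin) => [xl|[z /Sq]]; last by exists z.
  by rewrite xl st in nst.
have from_left r c : Left \in D r c ->
    exists2 c0 : 'I_n, c = c0.+1 :> nat & Right \in D r c0.
  move=> /has_strand_entry-/(_ (tilesD _ _) isT)[s' st].
  have [|[[r0 c0] [s0 s1]] st0] := prev ((r, c), (Left, s')) st.
    by rewrite /starts_at_bottom /= andbF.
  case: s1 st0 => //= st0; last by rewrite !andbF.
  case/and3P=> /eqP rr /eqP cc _; subst r0; exists c0 => //.
  by case: (has_strand_ends st0).
have to_right r c : Right \in D r c -> c.+1 != n ->
    exists2 c0 : 'I_n, c0 = c.+1 :> nat & Left \in D r c0.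
  move=> /has_strand_exit-/(_ (tilesD _ _) isT)[s' st] nc.
  have [|[[r0 c0] [s0 s1]] st0] := next ((r, c), (s', Right)) st.
    by rewrite /exits_at_right /= andbT.
  rewrite /= => /and3P[/eqP rr /eqP cc /eqP ss]; subst r0 s0.
  by exists c0 => //; case: (has_strand_ends st0).
have from_bottom r c : Bottom \in D r c -> r.+1 != n ->
    exists2 r0 : 'I_n, r0 = r.+1 :> nat & Top \in D r0 c.
  move=> /has_strand_entry-/(_ (tilesD _ _) isT)[s' st] nr.
  have [|[[r0 c0] [s0 s1]] st0] := prev ((r, c), (Bottom, s')) st.
    by rewrite /starts_at_bottom /= andbT.
  case: s1 st0 => //= st0; first by rewrite !andbF.
  case/and3P=> /eqP rr /eqP cc _; subst c0; exists r0 => //.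
  by case: (has_strand_ends st0).
have to_top r c : Top \in D r c ->
    exists2 r0 : 'I_n, r = r0.+1 :> nat & Bottom \in D r0 c.
  move=> /has_strand_exit-/(_ (tilesD _ _) isT)[s' st].
  have [|[[r0 c0] [s0 s1]] st0] := next ((r, c), (s', Top)) st.
    by rewrite /exits_at_right /= andbF.
  rewrite /= => /and3P[/eqP rr /eqP cc /eqP ss]; subst c0 s0.
  by exists r0 => //; case: (has_strand_ends st0).
split=> // [r c c' cc'|r r' c rr'|r c c0|r c r0|r c cn|r c rn].
- apply/idP/idP => [/from_left[c1 c1c]|/to_right[]].
  + by have -> : c1 = c by apply/val_inj => /=; lia.
  + by rewrite -cc'; have := ltn_ord c'; lia.
  by move=> c1 c1c; have -> : c1 = c' by apply/val_inj => /=; lia.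
- apply/idP/idP => [/to_top[r1 r1r]|/from_bottom[]].
  + by have -> : r1 = r by apply/val_inj => /=; lia.
  + by rewrite -rr'; have := ltn_ord r'; lia.
  by move=> r1 r1r; have -> : r1 = r' by apply/val_inj => /=; lia.
- by apply/negP => /from_left[c1 c1c _]; lia.
- by apply/negP => /to_top[r1 r1r _]; lia.
- (* [x0] is a default value: a pipe is not empty. *)
  pose x0 : strand n := ((r, c), (Left, Left)).
  pose g p : strand n := last x0 p.
  have gP p : p \in P ->
      [/\ g p \in p, is_strand D (g p) & exits_at_right (g p)].
    move=> pP; have := pipeP p pP; case: p pP => // y q yqP /and4P[Sq _ _ ex].
    by rewrite /g /= mem_last (allP Sq) ?mem_last.
  have [p pP|p q pP qP|p pP kr] :=
    @ends_everywhere n P g (fun x => x.1.1) sizeP uP _ _ r.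
  + by case: (gP p pP).
  + case: (gP _ pP) (gP _ qP) => _ + + [_ + +].
    case: (g p) (g q) => [[r1 c1] [s1 s1']] [[r2 c2] [s2 s2']] /=.
    rewrite /exits_at_right /is_strand /= => st1 /andP[/eqP c1n /eqP e1].
    move=> st2 /andP[/eqP c2n /eqP e2] r12; subst s1' s2' r2.
    have c12 : c2 = c1 by apply/val_inj => /=; lia.
    by subst c2; rewrite (has_strand_inj st1 st2).
  case: (gP _ pP) kr => _; case: (g p) => [[r1 c1] [s1 s1']] /=.
  rewrite /exits_at_right /is_strand /= => st1 /andP[/eqP c1n /eqP e1] r1r.
  subst r1 s1'; have c1c : c1 = c by apply/val_inj => /=; lia.
  by subst c1; case: (has_strand_ends st1).
- pose x0 : strand n := ((r, c), (Left, Left)).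
  pose g p : strand n := head x0 p.
  have gP p : p \in P ->
      [/\ g p \in p, is_strand D (g p) & starts_at_bottom (g p)].
    move=> pP; have := pipeP p pP; case: p pP => // y q yqP /and4P[Sq st _ _].
    by rewrite /g /= inE eqxx (allP Sq) // inE eqxx.
  have [p pP|p q pP qP|p pP kc] :=
    @ends_everywhere n P g (fun x => x.1.2) sizeP uP _ _ c.
  + by case: (gP p pP).
  + case: (gP _ pP) (gP _ qP) => _ + + [_ + +].
    case: (g p) (g q) => [[r1 c1] [s1 s1']] [[r2 c2] [s2 s2']] /=.
    rewrite /starts_at_bottom /is_strand /= => st1 /andP[/eqP r1n /eqP e1].
    move=> st2 /andP[/eqP r2n /eqP e2] c12; subst s1 s2 c2.
    have r12 : r2 = r1 by apply/val_inj => /=; lia.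
    by subst r2; rewrite (has_strand_fun st1 st2).
  case: (gP _ pP) kc => _; case: (g p) => [[r1 c1] [s1 s1']] /=.
  rewrite /starts_at_bottom /is_strand /= => st1 /andP[/eqP r1n /eqP e1] c1c.
  subst c1 s1; have r1r : r1 = r by apply/val_inj => /=; lia.
  by subst r1; case: (has_strand_ends st1).
Qed.

(** Strands that continue each other form the chains of a partial injection.
    A chain can only start at the bottom edge and only end at the right edge,
    and it has no cycle because pipes move right and up only. *)
Lemma coherent_bpd n (D : diagram n) : coherent D -> is_bpd D.
Proof.
move=> [tilesD hD vD leftD topD rightD bottomD]; split=> //.
case: n D tilesD hD vD leftD topD rightD bottomD => [|n] D.
  by move=> *; exists [::]; split=> // -[[[]]].
move=> tilesD hD vD leftD topD rightD bottomD.
pose S x := is_strand D x.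
pose m (x : strand n.+1) := (x.1.2 + (n.+1 - x.1.1))%N.
(* The tile decides whether the pipe that enters column [c] from below goes on
   upward or turns right. *)
pose start c : strand n.+1 :=
  ((ord_max, c),
   (Bottom, if has_strand (D ord_max c) Bottom Top then Top else Right)).
have S_start c : S (start c).
  have B := bottomD ord_max c erefl.
  have [s' st] := has_strand_entry (tilesD _ _) B isT.
  rewrite /S /is_strand /start /=; case: ifP => // /= nTop.
  by move: st => /=; case: s' => //=; rewrite nTop.
have startE x : S x -> starts_at_bottom x -> x = start x.1.2.
  case: x => [[r c] [s s']]; rewrite /S /is_strand /starts_at_bottom /=.
  move=> st /andP[/eqP rn /eqP sB]; subst s.
  have rmax : r = ord_max by apply/val_inj => /=; lia.
  by subst r; have := S_start c => /(has_strand_fun st) /= ->.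
pose starts := map start (enum 'I_n.+1).
have e_fun x y z : S x -> S y -> S z -> follows x y -> follows x z -> y = z.
  case: x y z => [[r c] [s s']] [[r1 c1] [s1 s1']] [[r2 c2] [s2 s2']].
  rewrite /S /is_strand /= => _ st1 st2; case: s' => //=.
  - move=> /and3P[/eqP ? /eqP e1 /eqP ?] /and3P[/eqP ? /eqP e2 /eqP ?].
    subst r1 s1 r2 s2; have ? : c2 = c1 by apply/val_inj => /=; lia.
    by subst c2; rewrite (has_strand_fun st1 st2).
  - move=> /and3P[/eqP e1 /eqP ? /eqP ?] /and3P[/eqP e2 /eqP ? /eqP ?].
    subst c1 s1 c2 s2; have ? : r2 = r1 by apply/val_inj => /=; lia.
    by subst r2; rewrite (has_strand_fun st1 st2).
have e_inj x y z : S x -> S y -> S z -> follows y x -> follows z x -> y = z.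
  case: x y z => [[r c] [s s']] [[r1 c1] [s1 s1']] [[r2 c2] [s2 s2']].
  rewrite /S /is_strand /= => _ st1 st2.
  case: s1' st1 => //= st1; case: s2' st2 => //= st2.
  - move=> /and3P[/eqP ? /eqP e1 /eqP ?] /and3P[/eqP ? /eqP e2 /eqP ?].
    subst r s r2; have ? : c2 = c1 by apply/val_inj => /=; lia.
    by subst c2; rewrite (has_strand_inj st1 st2).
  - by move=> /and3P[_ _ /eqP->] /and3P[].
  - by move=> /and3P[_ _ /eqP->] /and3P[].
  - move=> /and3P[/eqP e1 /eqP ? /eqP ?] /and3P[/eqP e2 /eqP ? /eqP ?].
    subst c s c2; have ? : r2 = r1 by apply/val_inj => /=; lia.
    by subst r2; rewrite (has_strand_inj st1 st2).
have no_prev x : x \in starts -> forall y, S y -> ~~ follows y x.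
  move=> /mapP[c _ ->] [[r1 c1] [s1 s1']] _ /=; case: s1' => //=.
    by rewrite !andbF.
  by rewrite andbT; have := ltn_ord r1; apply: contraL => /andP[/eqP -> _]; lia.
have has_prev x : S x -> x \notin starts -> exists2 y, S y & follows y x.
  case: x => [[r c] [s s']] Sx ns.
  have [sin _ ss _] := has_strand_ends Sx.
  case: s ss Sx ns sin => //= _ Sx ns sin.
    case: (posnP c) => [c0|c0]; first by have := leftD r c c0; rewrite sin.
    have ltc : (c.-1 < n.+1)%N by have := ltn_ord c; lia.
    rewrite (hD r (Ordinal ltc) c) in sin; last by rewrite /=; lia.
    have [s st] := has_strand_exit (tilesD _ _) sin isT.
    exists ((r, Ordinal ltc), (s, Right)) => //=.
    by rewrite eqxx andbT /=; lia.
  have [rn|rn] := eqVneq r.+1 n.+1.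
    case/negP: ns; rewrite (startE _ Sx) ?map_f ?mem_enum //.
    by rewrite /starts_at_bottom rn eqxx.
  have ltr : (r.+1 < n.+1)%N by have := ltn_ord r; lia.
  rewrite -(vD r (Ordinal ltr) c erefl) in sin.
  have [s st] := has_strand_exit (tilesD _ _) sin isT.
  by exists ((Ordinal ltr, c), (s, Top)); rewrite //= !eqxx.
have has_next x : S x -> ~~ exits_at_right x -> exists2 y, S y & follows x y.
  case: x => [[r c] [s s']] Sx.
  have [_ sin _] := has_strand_ends Sx.
  case: s' Sx sin => //= Sx sin _; rewrite /exits_at_right /= ?andbT => cn.
    have ltc : (c.+1 < n.+1)%N by have := ltn_ord c; lia.
    rewrite -(hD r c (Ordinal ltc) erefl) in sin.
    have [s' st] := has_strand_entry (tilesD _ _) sin isT.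
    by exists ((r, Ordinal ltc), (Left, s')); rewrite //= !eqxx.
  case: (posnP r) => [r0|r0]; first by have := topD r c r0; rewrite sin.
  have ltr : (r.-1 < n.+1)%N by have := ltn_ord r; lia.
  rewrite (vD (Ordinal ltr) r c) in sin; last by rewrite /=; lia.
  have [s' st] := has_strand_entry (tilesD _ _) sin isT.
  exists ((Ordinal ltr, c), (Bottom, s')) => //=.
  by rewrite eqxx andbT /=; lia.
have m_bound : exists N, forall x, (m x < N)%N.
  exists (n.+1 + n.+1)%N => -[[r c] ss]; rewrite /m /=.
  by have := ltn_ord c; lia.
have m_incr x y : follows x y -> (m x < m y)%N.
  case: x y => [[r c] [s s']] [[r1 c1] [s1 s1']]; rewrite /m.
  have := ltn_ord r; have := ltn_ord r1; case: s' => //= ? ?.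
    by case/and3P=> /eqP-> /eqP-> _; lia.
  by case/and3P=> /eqP rr /eqP-> _; lia.
have uniq_starts : uniq starts.
  by rewrite map_inj_uniq ?enum_uniq // => c c' [].
have S_starts : all S starts by apply/allP => _ /mapP[c _ ->].
have [Q [QP uQ inQ]] := chain_decomposition m_bound m_incr e_fun e_inj
  uniq_starts S_starts no_prev has_prev.
exists [seq x :: Q x | x <- starts]; split=> //.
  by rewrite 2!size_map size_enum_ord.
apply/allP => _ /mapP[x xs ->]; have [pq Sq maxq] := QP x xs.
rewrite /is_pipe Sq pq /=; apply/andP; split.
  by case/mapP: xs => c _ ->; rewrite /starts_at_bottom /= eqxx.
apply/negPn/negP => /has_next[]; first by apply: (allP Sq); apply: mem_last.
by move=> y /maxq/negP.
Qed.
(** * Pipes as level lines of the corner sum function *)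

(** The cell [(r, c)] has the vertices [(r, c)], [(r, c.+1)], [(r.+1, c)] and
    [(r.+1, c.+1)]; a pipe meets a side when [f] changes along that side. *)
Definition edge (f : nat -> nat -> int) (r c : nat) (s : side) : bool :=
  match s with
  | Left => f r.+1 c != f r c
  | Right => f r.+1 c.+1 != f r c.+1
  | Top => f r c.+1 != f r c
  | Bottom => f r.+1 c.+1 != f r.+1 c
  end.

Definition draw (n : nat) (f : nat -> nat -> int) : diagram n :=
  \matrix_(r, c) [set s | edge f r c s]%SET.

Lemma in_draw n f (r c : 'I_n) s : (s \in draw n f r c) = edge f r c s.
Proof. by rewrite mxE inE. Qed.

Lemma eq_draw n (f g : nat -> nat -> int) :
    (forall a b, (a <= n)%N -> (b <= n)%N -> f a b = g a b) ->
  draw n f = draw n g.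
Proof.
move=> fg; apply/matrixP => r c; apply/setP => s; rewrite !in_draw.
have [ltr ltc] := (ltn_ord r, ltn_ord c).
by rewrite /edge !fg // ltnW.
Qed.

Lemma coherent_draw n f : corner_function n f -> coherent (draw n f).
Proof.
case=> f0l f0r stepl stepr.
split=> [r c|r c c' e|r r' c e|r c e|r c e|r c e|r c e];
  rewrite ?in_draw /=; have [ltr ltc] := (ltn_ord r, ltn_ord c);
  have [ler lec] := (ltnW ltr, ltnW ltc).
- rewrite in_tiles !in_draw /=.
  have := stepl r c ltr lec; have := stepl r c.+1 ltr ltc.
  have := stepr r c ler ltc; have := stepr r.+1 c ltr ltc.
  lia.
- by rewrite e.
- by rewrite e.
- by rewrite e; have [-> _] := f0r _ ltr; have [-> _] := f0r _ ler.
- by rewrite e; have [-> _] := f0l _ ltc; have [-> _] := f0l _ lec.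
- by rewrite e; have [_ ->] := f0r _ ltr; have [_ ->] := f0r _ ler; lia.
- by rewrite e; have [_ ->] := f0l _ ltc; have [_ ->] := f0l _ lec; lia.
Qed.

Lemma r_tileE (t : cell) : (t == r_tile) =
  [&& Left \notin t, Right \in t, Top \notin t & Bottom \in t].
Proof. by rewrite cellE !inE; do 4!case: (_ \in t). Qed.

Lemma j_tileE (t : cell) : (t == j_tile) =
  [&& Left \in t, Right \notin t, Top \in t & Bottom \notin t].
Proof. by rewrite cellE !inE; do 4!case: (_ \in t). Qed.

Lemma bpd_asm_draw n f : corner_function n f ->
  bpd_asm (draw n f) = corner_matrix n f.
Proof.
case=> f0l f0r stepl stepr; apply/matrixP => r c; rewrite mxE [RHS]mxE.
have [ltr ltc] := (ltn_ord r, ltn_ord c).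
have [ler lec] := (ltnW ltr, ltnW ltc).
rewrite r_tileE j_tileE !in_draw /=.
have := stepl r c ltr lec; have := stepl r c.+1 ltr ltc.
have := stepr r c ler ltc; have := stepr r.+1 c ltr ltc.
do ?[case: ifP]; lia.
Qed.

Lemma corner_matrix_csum n (A : 'M[int]_n) : corner_matrix n (csum A) = A.
Proof. by apply/matrixP => r c; rewrite mxE -entry_csum. Qed.

(** Along a row, the entry of a tile records where a horizontal pipe begins or
    stops; along a column, where a vertical one does. *)
Lemma tile_entry n (D : diagram n) (r c : 'I_n) : D r c \in tiles ->
  bpd_asm D r c = (Right \in D r c)%:Z - (Left \in D r c)%:Z /\
  bpd_asm D r c = (Bottom \in D r c)%:Z - (Top \in D r c)%:Z.
Proof.
by rewrite mxE in_tiles r_tileE j_tileE; do 4!case: (_ \in D r c).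
Qed.

Section CoherentToMatrix.
Variables (n : nat) (D : diagram n).
Hypothesis cohD : coherent D.

Lemma psum_row_coherent (r c : 'I_n) :
  psum (bpd_asm D r) c = (Left \in D r c)%:Z.
Proof.
case: c => c; elim: c => [|c IH] ltc.
  by rewrite psum0 (negPf (coherent_left cohD _ _)).
have [e _] := tile_entry (coherent_tile cohD r (Ordinal (ltnW ltc))).
have := psumS (bpd_asm D r) (Ordinal (ltnW ltc)) => /= ->.
have := IH (ltnW ltc) => /= ->.
rewrite (@coherent_h _ _ cohD r (Ordinal (ltnW ltc)) (Ordinal ltc) erefl).
by rewrite e addrC subrK.
Qed.

Lemma psum_col_coherent (r c : 'I_n) :
  psum (fun x => bpd_asm D x c) r = (Top \in D r c)%:Z.
Proof.
case: r => r; elim: r => [|r IH] ltr.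
  by rewrite psum0 (negPf (coherent_top cohD _ _)).
have [_ e] := tile_entry (coherent_tile cohD (Ordinal (ltnW ltr)) c).
have := psumS (fun x => bpd_asm D x c) (Ordinal (ltnW ltr)) => /= ->.
have := IH (ltnW ltr) => /= ->.
rewrite (@coherent_v _ _ cohD (Ordinal (ltnW ltr)) (Ordinal ltr) c erefl).
by rewrite e addrC subrK.
Qed.

Lemma psum_rowS_coherent (r c : 'I_n) :
  psum (bpd_asm D r) c.+1 = (Right \in D r c)%:Z.
Proof.
rewrite psumS psum_row_coherent.
by have [-> _] := tile_entry (coherent_tile cohD r c); rewrite addrC subrK.
Qed.

Lemma psum_colS_coherent (r c : 'I_n) :
  psum (fun x => bpd_asm D x c) r.+1 = (Bottom \in D r c)%:Z.
Proof.
rewrite psumS psum_col_coherent.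
by have [_ ->] := tile_entry (coherent_tile cohD r c); rewrite addrC subrK.
Qed.

(** The partial sums of the entries along a row or a column recover the edges
    that are met, so a coherent diagram is determined by its matrix. *)
Lemma draw_coherent : draw n (csum (bpd_asm D)) = D.
Proof.
apply/matrixP => r c; apply/setP => s; rewrite in_draw.
case: s => /=.
- by rewrite csumSl psum_row_coherent; case: (_ \in _); lia.
- by rewrite csumSl psum_rowS_coherent; case: (_ \in _); lia.
- by rewrite csumSr psum_col_coherent; case: (_ \in _); lia.
- by rewrite csumSr psum_colS_coherent; case: (_ \in _); lia.
Qed.

Lemma is_asm_coherent : is_asm (bpd_asm D).
Proof.
split.
- by move=> r c; rewrite mxE !inE; do 2![case: ifP => //].
- move=> r c; have := psum_rowS_coherent r c; rewrite /psum /= => ->.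
  by rewrite !inE; case: (_ \in D r c).
- move=> c r; have := psum_colS_coherent r c; rewrite /psum /= => ->.
  by rewrite !inE; case: (_ \in D r c).
rewrite (eq_bigr (fun _ => 1)) ?sumr_const ?card_ord => [|r _]; first by lia.
have ltn : (n.-1 < n)%N by have := ltn_ord r; lia.
have := psum_rowS_coherent r (Ordinal ltn).
rewrite (coherent_right cohD) /=; last by lia.
by rewrite prednK ?psum_all //; lia.
Qed.

End CoherentToMatrix.
Lemma bpd_draw n (D : diagram n) : is_bpd D ->
  is_asm (bpd_asm D) /\ D = draw n (csum (bpd_asm D)).
Proof.
by move=> /bpd_coherent cohD; rewrite draw_coherent //; split=> //;
  apply: is_asm_coherent.
Qed.

Lemma draw_bpd n (A : 'M[int]_n) : is_asm A ->
  is_bpd (draw n (csum A)) /\ bpd_asm (draw n (csum A)) = A.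
Proof.
move=> /corner_csum cA; rewrite bpd_asm_draw // corner_matrix_csum; split=> //.
exact/coherent_bpd/coherent_draw.
Qed.

Lemma Phi_draw n (A : 'M[int]_n) : is_asm A -> Phi A = draw n (csum A).
Proof.
move=> asmA; apply: xget_unique; first exact: draw_bpd.
by move=> D [bD <-]; case: (bpd_draw bD).
Qed.

(** * The extreme corner sum functions that agree off one row *)

(** [lower] and [upper] put on the vertices between the rows [i] and [i.+1] of
    cells, which have first index [i.+1], the extreme values that the steps
    along columns permit. *)
Definition lower (i : nat) (f : nat -> nat -> int) (a b : nat) : int :=
  if a == i.+1 then Num.max (f i b) (f i.+2 b - 1) else f a b.

Definition upper (i : nat) (f : nat -> nat -> int) (a b : nat) : int :=
  if a == i.+1 then Num.min (f i b + 1) (f i.+2 b) else f a b.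

(** A maximum of two integer sequences with steps 0 or 1 has steps 0 or 1. *)
Lemma corner_lower n i f : (i.+1 < n)%N ->
  corner_function n f -> corner_function n (lower i f).
Proof.
move=> ltin [f0l f0r stepl stepr].
split=> [b leb|a lea|a b lta leb|a b lea ltb].
- by rewrite /lower /= gtn_eqF //; apply: f0l.
- rewrite /lower; case: eqP => [->|_]; last exact: f0r.
  by have [-> ->] := f0r _ (ltnW (ltnW ltin)); have [-> ->] := f0r _ ltin; lia.
- rewrite /lower eqSS; have := stepl a b lta leb.
  case: (eqVneq a i.+1) => [->|_]; case: (eqVneq _ i) => [e|_]; try lia.
    have := stepl i b (ltnW ltin) leb; lia.
  subst a; have := stepl i.+1 b ltin leb; lia.
- rewrite /lower; case: eqP => [_|_]; last exact: stepr.
  by have := stepr i b (ltnW (ltnW ltin)) ltb; have := stepr _ b ltin ltb; lia.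
Qed.

Lemma corner_upper n i f : (i.+1 < n)%N ->
  corner_function n f -> corner_function n (upper i f).
Proof.
move=> ltin [f0l f0r stepl stepr].
split=> [b leb|a lea|a b lta leb|a b lea ltb].
- by rewrite /upper /= gtn_eqF //; apply: f0l.
- rewrite /upper; case: eqP => [->|_]; last exact: f0r.
  by have [-> ->] := f0r _ (ltnW (ltnW ltin)); have [-> ->] := f0r _ ltin; lia.
- rewrite /upper eqSS; have := stepl a b lta leb.
  case: (eqVneq a i.+1) => [->|_]; case: (eqVneq _ i) => [e|_]; try lia.
    have := stepl i b (ltnW ltin) leb; lia.
  subst a; have := stepl i.+1 b ltin leb; lia.
- rewrite /upper; case: eqP => [_|_]; last exact: stepr.
  by have := stepr i b (ltnW (ltnW ltin)) ltb; have := stepr _ b ltin ltb; lia.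
Qed.

Lemma corner_between n i f a b : (i.+1 < n)%N -> (a <= n)%N -> (b <= n)%N ->
  corner_function n f -> lower i f a b <= f a b <= upper i f a b.
Proof.
move=> ltin lea leb [_ _ stepl _]; rewrite /lower /upper.
case: eqP => [->|_]; last by rewrite lexx.
by have := stepl i b (ltnW ltin) leb; have := stepl i.+1 b ltin leb; lia.
Qed.

Section Fiber.
Variables (n i : nat).
Hypothesis ltin : (i.+1 < n)%N.

Lemma agree_csum (A B : 'M[int]_n) : is_asm B ->
  agree_off_row i A B <->
  forall a b, (a <= n)%N -> (b <= n)%N -> a != i.+1 -> csum B a b = csum A a b.
Proof.
move=> asmB; split=> [[_ AB] [|a] [|b] lea leb ai|AB];
  rewrite ?csum0l ?csum0r //.
  exact: (AB (Ordinal lea) (Ordinal leb)).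
by split=> // a b ai; apply: (AB a.+1 b.+1) => //; apply: ltn_ord.
Qed.

Lemma agree_extreme (A B : 'M[int]_n) a b :
    is_asm B -> agree_off_row i A B -> (a <= n)%N -> (b <= n)%N ->
  lower i (csum B) a b = lower i (csum A) a b /\
  upper i (csum B) a b = upper i (csum A) a b.
Proof.
move=> asmB /(agree_csum _ asmB) AB lea leb.
have [ei ei2] : csum B i b = csum A i b /\ csum B i.+2 b = csum A i.+2 b.
  by split; apply: AB; lia.
by rewrite /lower /upper ei ei2; case: eqVneq => // /(AB a b)->.
Qed.

Lemma strong_le_csum (A B : 'M[int]_n) :
    (forall a b, (a <= n)%N -> (b <= n)%N -> csum B a b <= csum A a b) ->
  strong_le A B.
Proof. by move=> AB a b; apply: (AB a.+1 b.+1). Qed.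

Lemma strong_le_anti (A B : 'M[int]_n) :
  strong_le A B -> strong_le B A -> A = B.
Proof.
move=> AB BA; apply: csum_inj => -[|a] [|b] lea leb;
  rewrite ?csum0l ?csum0r //.
apply/eqP; rewrite eq_le (BA (Ordinal lea) (Ordinal leb)).
by rewrite (AB (Ordinal lea) (Ordinal leb)).
Qed.

Lemma agree_corner_matrix (A : 'M[int]_n) f : corner_function n f ->
    (forall a b, a != i.+1 -> f a b = csum A a b) ->
  agree_off_row i A (corner_matrix n f).
Proof.
move=> cf fA; apply/agree_csum; first exact: asm_corner_matrix.
by move=> a b lea leb ai; rewrite csum_corner_matrix // fA.
Qed.

Lemma agree_minimum (A : 'M[int]_n) : is_asm A ->
  is_minimum (agree_off_row i A) (corner_matrix n (upper i (csum A))).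
Proof.
move=> asmA; have cU := corner_upper ltin (corner_csum asmA); split.
  by apply: agree_corner_matrix => // a b /negPf ai; rewrite /upper ai.
move=> B AB; have asmB := AB.1; apply: strong_le_csum => a b lea leb.
rewrite csum_corner_matrix //; have [_ <-] := agree_extreme asmB AB lea leb.
by case/andP: (corner_between ltin lea leb (corner_csum asmB)).
Qed.

Lemma agree_maximum (A : 'M[int]_n) : is_asm A ->
  is_maximum (agree_off_row i A) (corner_matrix n (lower i (csum A))).
Proof.
move=> asmA; have cL := corner_lower ltin (corner_csum asmA); split.
  by apply: agree_corner_matrix => // a b /negPf ai; rewrite /lower ai.
move=> B AB; have asmB := AB.1; apply: strong_le_csum => a b lea leb.
rewrite csum_corner_matrix //; have [<- _] := agree_extreme asmB AB lea leb.
by case/andP: (corner_between ltin lea leb (corner_csum asmB)).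
Qed.

Lemma asm_piE (A : 'M[int]_n) : is_asm A ->
  asm_pi i A = corner_matrix n (upper i (csum A)).
Proof.
move=> asmA; have [agM minM] := agree_minimum asmA.
apply: xget_unique => // B [agB minB].
by apply: strong_le_anti; [apply: minB | apply: minM].
Qed.

(** [asm_pi i A] agrees with [A] off the line of vertices [i.+1], and it is
    determined by the values of the corner sums off that line. *)
Lemma asm_pi_fiberE (A C : 'M[int]_n) : is_asm A ->
  asm_pi_fiber i A C <-> agree_off_row i A C.
Proof.
move=> asmA; split=> [[asmC]|agC].
  rewrite !asm_piE // => eqpi; apply/agree_csum => // a b lea leb ai.
  have := congr1 (fun M => csum M a b) eqpi.
  rewrite !csum_corner_matrix //; do ?exact: corner_upper ltin (corner_csum _).
  by rewrite /upper (negPf ai).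
have asmC := agC.1; split=> //; rewrite !asm_piE //.
apply: csum_inj => a b lea leb.
rewrite !csum_corner_matrix //; do ?exact: corner_upper ltin (corner_csum _).
by case: (agree_extreme asmC agC lea leb).
Qed.

Lemma asm_pi_fiber_maximum (A : 'M[int]_n) : is_asm A ->
  is_maximum (asm_pi_fiber i A) (corner_matrix n (lower i (csum A))).
Proof.
move=> asmA; have [agM maxM] := agree_maximum asmA; split.
  by apply/asm_pi_fiberE.
by move=> B /(asm_pi_fiberE _ asmA)/maxM.
Qed.

End Fiber.

(** * Droppable column crossings *)

Section Intervals.
Variables (n i : nat) (D : diagram n).
Local Notation d := (dc i D).

Lemma dc_bound c : d c -> (c.+1 < n)%N.
Proof.
rewrite /dc /column_crossing => /andP[/andP[_ +] _]; rewrite /cell_at.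
case: (insub i : option 'I_n) => [r|]; last by rewrite inE.
by case: insubP => [c' + _ _|]; rewrite ?inE.
Qed.

Lemma dc_intervalP a b : reflect
  [/\ (a <= b)%N, forall x, (a <= x <= b)%N -> d x,
      (a == 0%N) || ~~ d a.-1 & ~~ d b.+1]
  (dc_interval i D a b).
Proof.
apply: (iffP and4P) => -[leab alld sta sto]; split=> //.
  by move=> x lex; apply: (allP alld); rewrite mem_iota; lia.
by apply/allP => x; rewrite mem_iota => xin; apply: alld; lia.
Qed.

(** The run of droppable crossings around [c] is bounded: on the left since
    indices are natural numbers, on the right by the last column. *)
Lemma dc_interval_around c : d c ->
  exists a b : 'I_n, dc_interval i D a b /\ (a <= c <= b)%N.
Proof.
move=> dcc; have ltcn := dc_bound dcc.
have [a [leac da sta]] : exists a, [/\ (a <= c)%N,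
    forall x, (a <= x <= c)%N -> d x & (a == 0%N) || ~~ d a.-1].
  elim: c dcc {ltcn} => [|c IH] dcc.
    by exists 0%N; split=> // x; rewrite leqn0 => /eqP->.
  have [dc'|ndc] := boolP (d c); last first.
    exists c.+1; split=> // x lex; by have -> : x = c.+1 by lia.
  have [a [leac da sta]] := IH dc'; exists a; split=> // [|x lex]; first by lia.
  have [->//|] := eqVneq x c.+1; by move=> xc; apply: da; lia.
have [b [lecb db sto]] : exists b, [/\ (c <= b)%N,
    forall x, (c <= x <= b)%N -> d x & ~~ d b.+1].
  have: exists b, (c <= b)%N && ~~ d b.+1.
    by exists n; rewrite ltnW ?(ltnW ltcn) //; apply/negP => /dc_bound; lia.
  move=> exb; case: (ex_minnP exb) => b /andP[lecb ndb] minb.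
  exists b; split=> // -[|x] lex; first by have <- : c = 0%N by lia.
  have [->//|xc] := eqVneq x.+1 c.
  by apply: contraTT lex => ndx; have := minb x; rewrite ndx; lia.
have ltbn := dc_bound (db b ltac:(lia)).
have ltan : (a < n)%N by lia.
exists (Ordinal ltan), (Ordinal (ltnW ltbn)); split=> /=; last by rewrite leac.
apply/dc_intervalP; split=> // [|x lex]; first by lia.
by have [lexc|ltcx] := leqP x c; [apply: da; lia | apply: db; lia].
Qed.

Definition dc_before (c : nat) : bool := (0 < c)%N && d c.-1.

(** The horizontal deletions cover a whole run; the vertical ones take place at
    the columns where a crossing to the right is droppable and the crossing
    from the left is not, which are the first columns of runs. *)
Lemma in_phi_deleted r c s : (s \in phi_deleted i D r c) =
  match s with
  | Left => (r == i) && dc_before c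
  | Right => (r == i) && d c
  | Top => (r == i.+1) && (d c && ~~ dc_before c)
  | Bottom => (r == i) && (d c && ~~ dc_before c)
  end.
Proof.
rewrite inE; apply/existsP/idP => [[a /existsP[b /andP[]]]|].
  move=> /dc_intervalP[leab dab sta sto].
  rewrite /on_horizontal /on_vertical /dc_before.
  case: s; rewrite ?andbF ?orbF /=.
  - by move=> /andP[-> lec] /=; rewrite dab; lia.
  - by move=> /andP[-> lec] /=; rewrite dab; lia.
  - case/andP=> /eqP-> ri; have -> : r = i.+1 by lia.
    by rewrite eqxx dab ?leqnn //= negb_and lt0n negbK.
  - case/andP=> /eqP-> ri; have -> : r = i by lia.
    by rewrite eqxx dab ?leqnn //= negb_and lt0n negbK.
have startE : d c && ~~ dc_before c -> exists b : 'I_n, exists2 a : 'I_n,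
    dc_interval i D a b & c = a.
  move=> /andP[dcc ndc]; have [a [b [Iab lec]]] := dc_interval_around dcc.
  exists b, a => //; have [_ dab _ _] := dc_intervalP _ _ Iab.
  have [//|ac] := eqVneq c a.
  by case/negP: ndc; rewrite /dc_before dab ?andbT; lia.
rewrite /on_horizontal /on_vertical; case: s.
- move=> /andP[-> /andP[c0 /dc_interval_around[a [b [Iab lec]]]]].
  by exists a; apply/existsP; exists b; rewrite Iab /=; lia.
- move=> /andP[-> /dc_interval_around[a [b [Iab lec]]]].
  by exists a; apply/existsP; exists b; rewrite Iab /=; lia.
- move=> /andP[/eqP-> /startE[b [a Iab ->]]].
  by exists a; apply/existsP; exists b; rewrite Iab /=; lia.
- move=> /andP[/eqP-> /startE[b [a Iab ->]]].
  by exists a; apply/existsP; exists b; rewrite Iab /=; lia.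
Qed.

(** Dually, the new vertical segments are at the columns [b.+1] that follow the
    last crossing of a run. *)
Lemma in_phi_drawn r c s : (s \in phi_drawn i D r c) =
  match s with
  | Left => (r == i.+1) && dc_before c
  | Right => (r == i.+1) && d c
  | Top => (r == i.+1) && (dc_before c && ~~ d c)
  | Bottom => (r == i) && (dc_before c && ~~ d c)
  end.
Proof.
rewrite inE; apply/existsP/idP => [[a /existsP[b /andP[]]]|].
  move=> /dc_intervalP[leab dab sta sto].
  rewrite /on_horizontal /on_vertical /dc_before.
  case: s; rewrite ?andbF ?orbF /=.
  - by move=> /andP[-> lec] /=; rewrite dab; lia.
  - by move=> /andP[-> lec] /=; rewrite dab; lia.
  - case/andP=> /eqP-> ri; have -> : r = i.+1 by lia.
    by rewrite eqxx sto dab //=; lia.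
  - case/andP=> /eqP-> ri; have -> : r = i by lia.
    by rewrite eqxx sto dab //=; lia.
have stopE : dc_before c && ~~ d c -> exists a : 'I_n, exists2 b : 'I_n,
    dc_interval i D a b & c = b.+1.
  move=> /andP[/andP[c0 dcc] ndc].
  have [a [b [Iab lec]]] := dc_interval_around dcc.
  exists a, b => //; have [_ dab _ _] := dc_intervalP _ _ Iab.
  have [//|bc] := eqVneq c b.+1.
  by case/negP: ndc; apply: dab; lia.
rewrite /on_horizontal /on_vertical; case: s.
- move=> /andP[-> /andP[c0 /dc_interval_around[a [b [Iab lec]]]]].
  by exists a; apply/existsP; exists b; rewrite Iab /=; lia.
- move=> /andP[-> /dc_interval_around[a [b [Iab lec]]]].
  by exists a; apply/existsP; exists b; rewrite Iab /=; lia.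
- move=> /andP[/eqP-> /stopE[a [b Iab ->]]].
  by exists a; apply/existsP; exists b; rewrite Iab /=; lia.
- move=> /andP[/eqP-> /stopE[a [b Iab ->]]].
  by exists a; apply/existsP; exists b; rewrite Iab /=; lia.
Qed.

End Intervals.

Lemma cell_atE n (D : diagram n) (r c : 'I_n) : cell_at D r c = D r c.
Proof. by rewrite /cell_at !valK. Qed.

(** The crossing from column [c] to column [c.+1] is tested at the vertical
    line [b = c.+1]. *)
Definition dropped (i : nat) (f : nat -> nat -> int) (b : nat) : bool :=
  (f i.+1 b != f i b) && (f i.+2 b == f i.+1 b).

Lemma dc_draw n i f c : (i.+1 < n)%N -> corner_function n f -> (c < n)%N ->
  dc i (draw n f) c = dropped i f c.+1.
Proof.
move=> ltin [_ f0r _ _] ltcn; have [ltc|lec] := ltnP c.+1 n.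
  have cE r c' (ltr : (r < n)%N) (ltc' : (c' < n)%N) :
      cell_at (draw n f) r c' = draw n f (Ordinal ltr) (Ordinal ltc').
    exact: (cell_atE _ (Ordinal ltr) (Ordinal ltc')).
  have ltin' := ltnW ltin.
  by rewrite /dc /column_crossing !cE !in_draw /= !andbb negbK.
(* On the right edge of the grid every row is crossed by a pipe, and there is
   no column to cross to: both sides are false. *)
have -> : c.+1 = n by lia.
apply/idP/idP => [/dc_bound|]; first by lia.
rewrite /dropped; have [_ ->] := f0r _ ltin.
by have [_ ->] := f0r _ (ltnW ltin); lia.
Qed.

Lemma dc_before_draw n i f c :
    (i.+1 < n)%N -> corner_function n f -> (c < n)%N ->
  dc_before i (draw n f) c = dropped i f c.
Proof.
move=> ltin cf; rewrite /dc_before; case: c => [_|c ltc]; last first.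
  by rewrite /= (dc_draw ltin cf (ltnW ltc)).
case: cf => _ f0r _ _; rewrite /dropped ltnn andFb.
have [-> _] := f0r _ (ltnW (ltnW ltin)).
by have [-> _] := f0r _ (ltnW ltin); rewrite eqxx.
Qed.

(** Lowering [f] by [dropped i f] on the line [i.+1] changes the step from [b]
    to [b.+1] there by the difference of [dropped] at the two ends.  So it
    removes a vertical edge where a run begins, creates one where a run ends,
    and leaves the others as they are. *)
Lemma phi_draw n i f : (i.+1 < n)%N -> corner_function n f ->
  phi i (draw n f) = draw n (lower i f).
Proof.
move=> ltin cf; apply/matrixP => r c; apply/setP => s.
rewrite in_draw mxE finset.in_setU finset.in_setD.
rewrite in_phi_deleted in_phi_drawn in_draw.
rewrite (dc_draw ltin cf (ltn_ord c)) (dc_before_draw ltin cf (ltn_ord c)).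
case: cf => _ _ stepl stepr; have [ltcn lecn] := (ltn_ord c, ltnW (ltn_ord c)).
have := stepl i c (ltnW ltin) lecn; have := stepl i c.+1 (ltnW ltin) ltcn.
have := stepl i.+1 c ltin lecn; have := stepl i.+1 c.+1 ltin ltcn.
have := stepr i c (ltnW (ltnW ltin)) ltcn; have := stepr _ c ltin ltcn.
have := stepr _ c (ltnW ltin) ltcn.
rewrite /dropped /edge /lower eqSS.
have [->|ri] := eqVneq (r : nat) i; first by rewrite ltn_eqF //; case: s; lia.
by have [->|ri1] := eqVneq (r : nat) i.+1; case: s; rewrite /=; lia.
Qed.

Theorem proposition5p2 (n i : nat) (hi : (i.+1 < n)%N) :
  (forall B : diagram n, is_bpd B -> is_bpd (phi i B)) /\
  (forall (A : 'M[int]_n) (B : diagram n), is_asm A -> B = Phi A ->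
     exists M : 'M[int]_n,
       is_maximum (asm_pi_fiber i A) M /\ phi i B = Phi M).
Proof.
split=> [B /bpd_draw[/corner_csum cB ->]|A _ asmA ->].
  rewrite phi_draw //; apply/coherent_bpd/coherent_draw.
  exact: corner_lower.
have cL := corner_lower hi (corner_csum asmA).
exists (corner_matrix n (lower i (csum A))); split.
  exact: asm_pi_fiber_maximum.
rewrite !Phi_draw //; last exact: asm_corner_matrix.
rewrite phi_draw //; last exact: corner_csum.
by apply: eq_draw => a b lea leb; rewrite csum_corner_matrix.
Qed.
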